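(* Let $k$ be a positive integer and let $G$ be a graph with $\kappa'(G)\geq k$ and $\delta(G)\geq k+2$. Then $G$ contains an edge $e=uv$ such that $\kappa'(G-\{u,v\})\geq k$.
   Context: All graphs are finite, undirected, without loops or multiple edges. $\delta(G)$ is the minimum degree of $G$. For $S\subseteq V(G)$, $G-S$ denotes the subgraph of $G$ induced by $V(G)\setminus S$. The edge-connectivity $\kappa'(G)$ is the minimum size of an edge set $U\subseteq E(G)$ such that $G-U$ is disconnected; a graph is $k$-edge-connected if $\kappa'(G)\geq k$. By convention a trivial (one-vertex) graph is $1$-edge-connected but not $k$-edge-connected for any $k>1$. *)

(* Defs.v *)
(* A finite simple graph is a symmetric irreflexive
   relation e : rel T on a finType T. Vertex subsets S : {set T} denote
   induced subgraphs G[S]; G - S is the induced subgraph on ~: S. *)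
From mathcomp Require Import all_boot.
Set Implicit Arguments. Unset Strict Implicit. Unset Printing Implicit Defensive.

Section Graphs.
Variable T : finType.
Variable e : rel T.

Definition deg (x : T) : nat := #|[set y | e x y]|.

Definition sub_rel (S : {set T}) (U : {set {set T}}) : rel T :=
  fun a b => [&& e a b, a \in S, b \in S & [set a; b] \notin U].

(* G[S] - U is connected (graphs have nonempty vertex sets) *)
Definition connected_minus (S : {set T}) (U : {set {set T}}) : Prop :=
  S != set0 /\ forall x y, x \in S -> y \in S -> connect (sub_rel S U) x y.

(* kappa'(G[S]) >= k: deleting fewer than k edges never disconnects G[S];
   by convention the trivial (one-vertex) graph is not k-edge-connected
   for k > 1. *)
Definition k_edge_connected (k : nat) (S : {set T}) : Prop :=
  (1 < k -> 1 < #|S|) /\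
  forall U : {set {set T}}, #|U| < k -> connected_minus S U.
End Graphs.

(* Main.v *)
Require Import Defs.
From mathcomp Require Import all_boot zify.

(** Suppose that deleting the ends of any edge leaves a graph with a cut of fewer
   than [k] edges, and consider minimum such cuts.
   Juxtaposition of sets denotes intersection.

   First, as in Mader's theorem on single vertices: among the minimum cuts [A | B]
   of graphs [G - w] that are not [k]-edge-connected, take [A] of minimum size;
   uncrossing shows that every vertex of [A] without neighbours in [B] is
   removable. Inside [A + w] (or in the whole graph if every vertex is removable)
   choose an edge [uv] of such vertices and a minimum cut [A | B] of [G - u - v]
   with [|A|] minimum. Let [Z] be the set of vertices of [A] without neighbours in
   [B]; no vertex of [Z] is adjacent to [u] or [v], and by uncrossing every
   minimum cut [C | D] of [G - x - y], for an edge [xy] in [Z], separates [u] (in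
   [C]) from [v] (in [D]). Choose it with [|A D|] minimum. Counting degrees gives an edge
   [zz'] of [Z] inside [A D] without neighbours in [B] or [C]; let [C' | D'] be a
   minimum cut of [G - z - z'].

   Counting edges across the three cuts, as [G - u] and [G - v] are
   [k]-edge-connected, shows that [B C C'] and [B D D'] are nonempty, and then that
   [A C D'] is empty. By the choice of [xy] this forces [A D = A D D' + z + z'] and
   [x, y] in [D'], so that [z] and [z'] have no neighbour in [C'], and fewer than [k]
   edges of [G] leave [C']. *)

Section RemovableEdge.
Set Implicit Arguments.
Unset Strict Implicit.
Unset Printing Implicit Defensive.
Variables (T : finType) (e : rel T) (k : nat).
Hypothesis e_sym : symmetric e.
Hypothesis e_irr : irreflexive e.
Implicit Types (S X Y A B C D F M J W : {set T}) (a b t u v : T).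

(** * Counting edges between vertex sets *)

Definition ecount X Y : nat := \sum_(a in X) \sum_(b in Y) e a b.

(** Symmetrising over the two orders of a pair makes comparisons of [ecount] checkable edge by
    edge. *)
Definition both X Y a b : nat :=
  ((a \in X) && (b \in Y)) + ((b \in X) && (a \in Y)).

Lemma ecount_both X Y :
  ecount X Y + ecount X Y = \sum_a \sum_b e a b * both X Y a b.
Proof.
have E1 : ecount X Y = \sum_a \sum_b e a b * ((a \in X) && (b \in Y)).
  rewrite /ecount big_mkcond; apply: eq_bigr => a _.
  case: (a \in X) => /=; last by rewrite big1 // => b _; rewrite muln0.
  rewrite big_mkcond; apply: eq_bigr => b _.
  by case: (b \in Y); rewrite ?muln0 ?muln1.
rewrite {2}E1 exchange_big E1 -big_split; apply: eq_bigr => a _.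
rewrite -big_split; apply: eq_bigr => b _.
by rewrite /= (e_sym b a) -mulnDr.
Qed.

(** Every edge is seen from both ends, so twice each total is a sum of [both] over ordered adjacent
    pairs, which is compared termwise. Cut inequalities thus become finite checks on the memberships
    of [a] and [b]. *)
Lemma leq_ecounts (L R : seq ({set T} * {set T})) :
  (forall a b, e a b -> \sum_(p <- L) both p.1 p.2 a b <=
                        \sum_(p <- R) both p.1 p.2 a b) ->
  \sum_(p <- L) ecount p.1 p.2 <= \sum_(p <- R) ecount p.1 p.2.
Proof.
move=> le_both.
have dbl (Q : seq ({set T} * {set T})) :
    (\sum_(p <- Q) ecount p.1 p.2).*2 =
    \sum_a \sum_b e a b * \sum_(p <- Q) both p.1 p.2 a b.
  rewrite -addnn -big_split /= (eq_bigr _ (fun p _ => ecount_both p.1 p.2)).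
  rewrite exchange_big; apply: eq_bigr => a _.
  rewrite exchange_big; apply: eq_bigr => b _.
  by rewrite big_distrr.
rewrite -leq_double !dbl; apply: leq_sum => a _; apply: leq_sum => b _.
by case eab: (e a b); rewrite ?mul0n // !mul1n le_both.
Qed.

Lemma ecountC X Y : ecount X Y = ecount Y X.
Proof.
rewrite /ecount exchange_big; apply: eq_bigr => b _.
by apply: eq_bigr => a _; rewrite e_sym.
Qed.

Lemma card_nbr Y a : \sum_(b in Y) e a b = #|[set b in Y | e a b]|.
Proof.
rewrite -sum1_card big_mkcond [RHS]big_mkcond; apply: eq_bigr => b _.
by rewrite inE; case: (b \in Y); case: (e a b).
Qed.

(** * Vertex partitions and small cuts *)

Definition part S C D :=
  [&& C != set0, D != set0, C :|: D == S & [disjoint C & D]].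

Definition mincut S C D :=
  [&& part S C D, ecount C D < k &
      [forall X, forall Y, part S X Y ==> (ecount C D <= ecount X Y)]].

(** Edge-connectivity through vertex partitions. A one-vertex [S] satisfies it vacuously, so the
    size clause of [k_edge_connected] is treated separately. *)
Definition kconn S := forall C D, part S C D -> k <= ecount C D.

Lemma partC S C D : part S C D = part S D C.
Proof.
by rewrite /part setUC disjoint_sym andbCA.
Qed.

Lemma mincutC S C D : mincut S C D -> mincut S D C.
Proof.
by case/and3P => pCD lt_k min; rewrite /mincut partC pCD ecountC lt_k.
Qed.

Lemma partP S C D :
  reflect [/\ C != set0, D != set0 &
     forall t, ((t \in S) == (t \in C) || (t \in D)) && ~~ ((t \in C) && (t \in D))]
   (part S C D).
Proof.
apply: (iffP and4P) => [[C0 D0 /eqP <- dis]|[C0 D0 CD]]; split=> //.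
- move=> t; rewrite inE eqxx /=; apply/negP => /andP[tC].
  by rewrite (disjointFr dis tC).
- by apply/eqP/setP => t; have /andP[/eqP -> _] := CD t; rewrite inE.
- by apply/pred0P => t /=; have /andP[_ /negPf] := CD t.
Qed.

Lemma mincutP S C D :
  reflect [/\ part S C D, ecount C D < k &
     forall X Y, part S X Y -> ecount C D <= ecount X Y] (mincut S C D).
Proof.
apply: (iffP and3P) => [[p lt /forallP min]|[p lt min]]; split=> //.
  by move=> X Y; apply/implyP; have /forallP := min X.
by apply/forallP => X; apply/forallP => Y; apply/implyP/min.
Qed.

Lemma kconnVmincut S : kconn S \/ exists C D, mincut S C D.
Proof.
pose Q (p : {set T} * {set T}) := part S p.1 p.2 && (ecount p.1 p.2 < k).
case: (pickP Q) => [p0 Qp0|noQ]; last first.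
  left=> C D pCD; have := noQ (C, D).
  by rewrite /Q pCD /= => /negbT; rewrite -leqNgt.
right; case: (arg_minnP (fun p => ecount p.1 p.2) Qp0) => -[C D] /andP[/= pCD lt] min.
exists C, D; apply/mincutP; split=> // X Y pXY; rewrite leqNgt; apply/negP => lt'.
by have := min (X, Y); rewrite /Q /= pXY (ltn_trans lt' lt) => /(_ isT); rewrite leqNgt lt'.
Qed.

(* Either every member of [X] has a neighbour outside, and then a single vertex
   already forces [d] boundary edges, or some vertex has none; its [d]
   neighbours all lie in [X], and fewer than [d] of them can have an outside one. *)
Lemma interior_edge d X M :
  X != set0 -> (forall t, d <= #|[set b | e t b] :\: M|) ->
  ecount X (~: (X :|: M)) < d ->
  exists z z', [/\ z \in X, z' \in X, e z z',
    forall b, e z b -> b \in X :|: M & forall b, e z' b -> b \in X :|: M].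
Proof.
move=> /set0Pn[t0 t0X] mindeg lt_d.
set O := ~: (X :|: M) in lt_d *.
pose out t := #|[set b in O | e t b]|.
have EO : ecount X O = \sum_(t in X) out t.
  by apply: eq_bigr => t _; rewrite card_nbr.
pose bad := [set t in X | 0 < out t].
have le_bad : #|bad| <= ecount X O.
  rewrite EO -sum1_card [leqRHS](bigID (fun t => 0 < out t)) /=.
  apply: leq_trans (leq_addr _ _).
  rewrite (eq_bigl (fun t => (t \in X) && (0 < out t))); last by move=> t; rewrite inE.
  by apply: leq_sum => t /andP[].
have goodP t : t \in X -> t \notin bad -> forall b, e t b -> b \in X :|: M.
  move=> tX; rewrite inE tX /= -eqn0Ngt cards_eq0 => /eqP out0 b etb.
  by have := in_set0 b; rewrite -out0 inE etb andbT /O inE => /negbFE.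
have [z zX zgood] : exists2 z, z \in X & z \notin bad.
  apply/exists_inP; rewrite -[X in is_true X]negbK negb_exists_in; apply/negP.
  move=> /forall_inP allbad; suff : d <= ecount X O by rewrite leqNgt lt_d.
  apply: leq_trans (mindeg t0) _.
  rewrite EO (bigD1 t0) //=.
  (* Each neighbour of [t0] inside [X] is itself bad, so it adds at least one outgoing edge to the
     sum. *)
  have -> : [set b | e t0 b] :\: M =
     [set b in O | e t0 b] :|: [set b in X :\ t0 | e t0 b] :\: M.
    apply/setP => b; rewrite !inE.
    have [->|_] := eqVneq b t0; first by rewrite e_irr !andbF.
    by case: (b \in X) (b \in M) (e t0 b) => [] [] [].
  apply: leq_trans (leq_card_setU _ _) _; rewrite leq_add2l.
  apply: (@leq_trans #|X :\ t0|).
    by apply: subset_leq_card; apply/subsetP => b; rewrite !inE => /andP[_ /andP[]].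
  rewrite -sum1_card (eq_bigl (fun t => (t \in X) && (t != t0))); last first.
    by move=> t; rewrite !inE andbC.
  apply: leq_sum => t /andP[tX _].
  by have := allbad t tX; rewrite negbK inE tX.
have [z' z'N z'good] : exists2 z', z' \in [set b | e z b] :\: M & z' \notin bad.
  apply/subsetPn; apply/negP => /subset_leq_card le.
  by have := leq_ltn_trans (leq_trans (mindeg z) (leq_trans le le_bad)) lt_d; rewrite ltnn.
move: z'N; rewrite !inE => /andP[z'M ezz'].
have z'X : z' \in X.
  by have := goodP z zX zgood z' ezz'; rewrite inE (negPf z'M) orbF.
by exists z, z'; split=> //; apply: goodP.
Qed.

(** A computable quantifier: once all memberships are generalized, the remaining closed formula is
    decided by evaluation. *)
Definition all_bool (P : bool -> bool) : bool := P true && P false.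

Lemma all_boolP (P : bool -> bool) : all_bool P -> forall x, P x.
Proof. by case/andP=> Pt Pf []. Qed.

(* Abstracts the membership atoms one by one and checks the Boolean formula. *)
Ltac merge_imp := match goal with
  | |- is_true _ -> _ => let H := fresh in move=> H; merge_imp; move: H; apply/implyP
  | _ => idtac end.

Ltac truth_table := merge_imp; rewrite ?inE; repeat match goal with
    | |- context [in_mem ?t ?m] => generalize (in_mem t m); apply: all_boolP
    | |- context [@eq_op ?E ?t ?u] => lazymatch type of t with
        bool => fail | _ => generalize (@eq_op E t u); apply: all_boolP end
  end; vm_compute; reflexivity.

(** * Uncrossing two minimum cuts *)

Lemma part_setD S X :
  X \subset S -> X != set0 -> S :\: X != set0 -> part S X (S :\: X).
Proof.
move=> /subsetP XS X0 Y0; apply/partP; split=> // t.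
move/implyP: (XS t); truth_table.
Qed.

(** If [F] sent no edge to [D], the boundary of [D] in [S] would be the cut itself, which has fewer
    than [k] edges. *)
Lemma cut_attached S F C D :
  kconn S -> F \subset S -> part (S :\: F) C D -> ecount C D < k ->
  exists a b, [/\ a \in F, b \in D & e a b].
Proof.
move=> kS FS pCD ltCD; have /partP[C0 D0 CD] := pCD.
suff /exists_inP[a aF /exists_inP[b bD eab]] : [exists a in F, [exists b in D, e a b]].
  by exists a, b.
rewrite -[X in is_true X]negbK negb_exists_in; apply/negP => /forall_inP FD.
have FDe a b : e a b -> (a \in F) ==> (b \notin D).
  move=> eab; apply/implyP => aF; apply: contraL eab => bD.
  by have := FD a aF; rewrite negb_exists_in => /forall_inP; apply.
have facts t : ((t \in F) ==> (t \in S)) &&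
   (((t \in S :\: F) == (t \in C) || (t \in D)) && ~~ ((t \in C) && (t \in D))).
  by rewrite CD andbT; apply/implyP; apply: (subsetP FS).
have pS : part S D (S :\: D).
  apply: part_setD => //.
    by apply/subsetP => t; move: (facts t); truth_table.
  have /set0Pn[c cC] := C0; apply/set0Pn; exists c.
  by move: (facts c) cC; truth_table.
have := kS _ _ pS; rewrite leqNgt => /negP; apply.
apply: leq_ltn_trans ltCD.
have := @leq_ecounts [:: (D, S :\: D)] [:: (C, D)].
rewrite !big_seq1; apply=> a b eab; rewrite !big_seq1 /both /=.
have nab := FDe a b eab; rewrite e_sym in eab; have nba := FDe b a eab.
by move: nab nba (facts a) (facts b); truth_table.
Qed.

(* Uncrossing: the corners [A D] and [B C] satisfy
   [e(A D, -) + e(B C, -) <= e(A, B) + e(C, D)]. *)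
Lemma mincut_shift S F F' A B C D :
  kconn S -> F \subset S -> F' \subset S -> F' != set0 ->
  mincut (S :\: F) A B -> F' \subset A -> {in F' & B, forall a b, ~~ e a b} ->
  mincut (S :\: F') C D -> F \subset C ->
  exists Y Y', [/\ mincut (S :\: F') Y Y', Y \subset A :|: F
                 & #|F| <= #|F'| -> #|Y| < #|A|].
Proof.
move=> kS FS F'S F'0 /mincutP[pAB ltAB minAB] F'A F'B /mincutP[pCD ltCD minCD] FC.
have /partP[A0 B0 AB] := pAB; have /partP[C0 D0 CD] := pCD.
have facts t : [&& (t \in F) ==> (t \in C), (t \in F) ==> (t \in S),
    (t \in F') ==> (t \in A),
    ((t \in S :\: F) == (t \in A) || (t \in B)) && ~~ ((t \in A) && (t \in B)) &
    ((t \in S :\: F') == (t \in C) || (t \in D)) && ~~ ((t \in C) && (t \in D))].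
  rewrite AB CD !andbT; apply/and3P; split; apply/implyP; exact: (subsetP _ t).
(* [F'] has a neighbour in [D]; it is not in [B] by hypothesis, nor in [F], which lies in [C]. *)
have AD0 : A :&: D != set0.
  apply/negP => /eqP AD0.
  have [a [b [aF' bD]]] := cut_attached kS F'S pCD ltCD.
  apply/negP; apply: F'B => //; have : b \notin A :&: D by rewrite AD0 inE.
  by move: (facts b) bD; truth_table.
have card_eq : #|A :&: C| + #|A :&: D| + #|F'| = #|A|.
  have <- : #|A :&: C| + #|A :\: C| = #|A| by apply: cardsID.
  have <- : #|(A :\: C) :&: D| + #|(A :\: C) :\: D| = #|A :\: C| by apply: cardsID.
  rewrite -addnA; congr (_ + (_ + _)); apply: eq_card => t; apply/eqP;
    by move: (facts t); truth_table.
(* Without the corner [B :&: C], the side [C] itself serves: compared with [A] it gains [F] but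
   loses [F'] and the nonempty [A :&: D]. *)
have [BC0|BC0] := eqVneq (B :&: C) set0.
  have CE : C = (A :&: C) :|: F.
    apply/setP => t; apply/eqP; have : t \notin B :&: C by rewrite BC0 inE.
    by move: (facts t); truth_table.
  exists C, D; split; first exact/mincutP.
    by rewrite CE setSU // subsetIl.
  move=> leF; have := (leq_card_setU (A :&: C) F).1; rewrite -CE => leC.
  by move: AD0 leF leC card_eq; rewrite -card_gt0; clear; lia.
have pY : part (S :\: F') (A :&: D) ((S :\: F') :\: (A :&: D)).
  apply: part_setD => //.
    by apply/subsetP => t; move: (facts t); truth_table.
  have /set0Pn[c cC] := C0; apply/set0Pn; exists c.
  by move: (facts c) cC; truth_table.
have pX : part (S :\: F) (B :&: C) ((S :\: F) :\: (B :&: C)).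
  apply: part_setD => //.
    by apply/subsetP => t; move: (facts t); truth_table.
  have /set0Pn[c cA] := A0; apply/set0Pn; exists c.
  by move: (facts c) cA; truth_table.
have uncross : ecount (A :&: D) ((S :\: F') :\: (A :&: D))
    + ecount (B :&: C) ((S :\: F) :\: (B :&: C)) <= ecount A B + ecount C D.
  have := @leq_ecounts
     [:: (A :&: D, (S :\: F') :\: (A :&: D)); (B :&: C, (S :\: F) :\: (B :&: C))]
     [:: (A, B); (C, D)].
  rewrite !big_cons !big_nil /= !addn0; apply=> a b _.
  rewrite !big_cons !big_nil /both /=.
  by move: (facts a) (facts b); truth_table.
(* Minimality of [[A | B]] bounds the other corner from below, so [A :&: D] gives a cut no larger
   than [[C | D]]. *)
have leCD : ecount (A :&: D) ((S :\: F') :\: (A :&: D)) <= ecount C D.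
  by move: (minAB _ _ pX) uncross; clear; lia.
exists (A :&: D), ((S :\: F') :\: (A :&: D)); split.
- apply/mincutP; split=> [//||X Y /minCD]; first exact: leq_ltn_trans ltCD.
  exact: leq_trans.
- by apply/subsetP => t; rewrite !inE => /andP[-> _].
by move=> _; move: F'0 card_eq; rewrite -card_gt0; clear; lia.
Qed.

Lemma part_compl F C D : part (~: F) C D ->
  (forall t, ~~ ((t \in C) && (t \in D))) /\ F = ~: (C :|: D).
Proof.
case/partP=> _ _ CD; split=> [t|]; first by case/andP: (CD t).
by apply/setP => t; have /andP[/eqP + _] := CD t; rewrite !inE => <-; rewrite negbK.
Qed.

(** * Edge counts across two and three crossing cuts *)

Section ThreeCuts.
Variables A B C D C' D' U V F F' : {set T}.
Hypotheses (partAB : part (~: (U :|: V)) A B) (partCD : part (~: F) C D).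
Hypotheses (FA : F \subset A) (UC : U \subset C) (VD : V \subset D).

(** Edges between [U] and [V] cross [[C | D]] and touch neither corner, since [U] and [V] lie
    outside [A] and [B]; hence the extra summand on the left. *)
Lemma ecount_two_cuts :
  ecount (A :&: D) (~: (A :&: D :|: (F :|: V)))
  + ecount (B :&: C) (~: (B :&: C :|: (U :|: V))) + ecount U V
  <= ecount A B + ecount C D.
Proof.
have [disAB defUV] := part_compl partAB; have [disCD defF] := part_compl partCD.
have facts t : [&& ~~ ((t \in A) && (t \in B)), ~~ ((t \in C) && (t \in D)),
    (t \in ~: (C :|: D)) ==> (t \in A), (t \in U) ==> (t \in C),
    (t \in V) ==> (t \in D) & (t \in U :|: V) == (t \in ~: (A :|: B))].
  rewrite disAB disCD -defF -defUV eqxx andbT /=.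
  by apply/and3P; split; apply/implyP; apply: (subsetP _ t).
have := @leq_ecounts
  [:: (A :&: D, ~: (A :&: D :|: (F :|: V))); (B :&: C, ~: (B :&: C :|: (U :|: V)));
      (U, V)] [:: (A, B); (C, D)].
rewrite !big_cons !big_nil /= !addn0 addnA; apply=> a b _.
rewrite !big_cons !big_nil /both /= defF.
move: (facts a) (facts b); truth_table.
Qed.

Hypotheses (partCD' : part (~: F') C' D').
Hypotheses (F'A : F' \subset A) (UC' : U \subset C') (VD' : V \subset D').

Lemma three_cuts_facts t :
  [&& ~~ ((t \in C) && (t \in D)), ~~ ((t \in C') && (t \in D')),
    ~~ ((t \in U) && (t \in A)), ~~ ((t \in V) && (t \in A)),
    (t \in ~: (C :|: D)) ==> (t \in A),
    (t \in ~: (C' :|: D')) ==> (t \in A),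
    (t \in U) ==> (t \in C) && (t \in C') & (t \in V) ==> (t \in D) && (t \in D')].
Proof.
have [disCD defF] := part_compl partCD; have [disCD' defF'] := part_compl partCD'.
have /partP[_ _ /(_ t)] := partAB.
have /implyP := subsetP FA t; have /implyP := subsetP F'A t.
have /implyP := subsetP UC t; have /implyP := subsetP UC' t.
have /implyP := subsetP VD t; have /implyP := subsetP VD' t.
move: (disCD t) (disCD' t); rewrite -defF -defF'; truth_table.
Qed.

Lemma side_compl : B = ~: (A :|: U :|: V).
Proof.
have [disAB defUV] := part_compl partAB; rewrite -setUA defUV.
apply/setP => t; apply/eqP; move: (disAB t); truth_table.
Qed.

(* Since [B D] and [B D'] are disjoint, an edge from [A D D'] to [B] is counted
   at most once by the two petals but at least twice on the right; the excess
   pays for the last summand. *)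
Lemma ecount_petals : B :&: (D :&: D') = set0 ->
  ecount (B :&: D) (~: (B :&: D :|: V)) + ecount (B :&: D') (~: (B :&: D' :|: V))
  + ecount V (C :|: C') + ecount (A :&: (D :&: D')) B
  <= ecount A B + ecount C D + ecount C' D'.
Proof.
move=> BDD'; have facts := three_cuts_facts.
have BDD't t : t \notin B :&: (D :&: D') by rewrite BDD' inE.
have := @leq_ecounts
  [:: (B :&: D, ~: (B :&: D :|: V)); (B :&: D', ~: (B :&: D' :|: V));
      (V, C :|: C'); (A :&: (D :&: D'), B)] [:: (A, B); (C, D); (C', D')].
rewrite !big_cons !big_nil /= !addn0 !addnA; apply=> a b _.
rewrite !big_cons !big_nil /both /=; rewrite side_compl in BDD't *.
move: (facts a) (facts b) (BDD't a) (BDD't b); truth_table.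
Qed.

(* The corners [B C C'], [B D D'] and [A C D'] are pairwise separated by two of
   the three cuts, so an edge joining two of them is also counted twice on the right. *)
Lemma ecount_corners : F' \subset D ->
  ecount (B :&: (C :&: C')) (~: (B :&: (C :&: C') :|: U))
  + ecount (B :&: (D :&: D')) (~: (B :&: (D :&: D') :|: V))
  + ecount (A :&: (C :&: D')) (~: F :\: (A :&: (C :&: D')))
  <= ecount A B + ecount C D + ecount C' D'.
Proof.
move=> F'D; have facts := three_cuts_facts.
have [_ defF] := part_compl partCD; have [_ defF'] := part_compl partCD'.
have factF' t : (t \in ~: (C' :|: D')) ==> (t \in D).
  by rewrite -defF'; apply/implyP; apply: (subsetP F'D).
have := @leq_ecounts
  [:: (B :&: (C :&: C'), ~: (B :&: (C :&: C') :|: U));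
      (B :&: (D :&: D'), ~: (B :&: (D :&: D') :|: V));
      (A :&: (C :&: D'), ~: F :\: (A :&: (C :&: D')))]
  [:: (A, B); (C, D); (C', D')].
rewrite !big_cons !big_nil /= !addn0 !addnA; apply=> a b _.
rewrite !big_cons !big_nil /both /= defF side_compl.
move: (facts a) (facts b) (factF' a) (factF' b); truth_table.
Qed.

End ThreeCuts.

(** * Small cuts versus edge deletions *)

Lemma ecount_card X Y :
  ecount X Y = #|[set p : T * T | [&& p.1 \in X, p.2 \in Y & e p.1 p.2]]|.
Proof.
rewrite /ecount pair_big /= -sum1_card [RHS]big_mkcond [LHS]big_mkcond.
apply: eq_bigr => -[a b] _; rewrite inE /=.
by case: (a \in X); case: (b \in Y); case: (e a b).
Qed.

(** Deleting the edges between [C] and [D], encoded as doubletons, leaves [C] closed under adjacency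
    in [S]. *)
Lemma k_edge_connected_kconn S : k_edge_connected e k S -> kconn S.
Proof.
case=> _ conn C D pCD; rewrite leqNgt; apply/negP => ltCD.
have /partP[/set0Pn[c cC] /set0Pn[d dD] CD] := pCD.
pose U := [set [set p.1; p.2] | p in
  [set p : T * T | [&& p.1 \in C, p.2 \in D & e p.1 p.2]]].
have ltU : #|U| < k.
  by apply: leq_ltn_trans ltCD; rewrite ecount_card; apply: leq_imset_card.
have inU a b : e a b -> a \in C -> b \in D -> [set a; b] \in U.
  by move=> eab aC bD; apply/imsetP; exists (a, b); rewrite ?inE ?aC ?bD.
have [_ /(_ c d)] := conn U ltU.
have [cS dS] : c \in S /\ d \in S.
  by have := CD c; have := CD d; rewrite cC dD orbT => /andP[/eqP-> _] /andP[/eqP-> _].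
move=> /(_ cS dS) /(@closed_connect _ _ (mem C)) same.
have := CD d; rewrite dD -same ?cC ?andbF // => a b /and4P[eab aS bS abU].
have := CD a; have := CD b; rewrite aS bS /=.
case aC: (a \in C); case bC: (b \in C) => //= bD aD.
  by rewrite inU // in abU; rewrite andbT in bD; apply/eqP; rewrite eq_sym.
rewrite setUC inU // in abU; first by rewrite e_sym.
by rewrite andbT in aD; apply/eqP; rewrite eq_sym.
Qed.

(** If [y] is unreachable from [x], all edges leaving the component of [x] lie in [U]. Such pairs
    start in the component, so distinct pairs give distinct doubletons. *)
Lemma kconn_k_edge_connected S : 1 < #|S| -> kconn S -> k_edge_connected e k S.
Proof.
move=> S1 kS; split=> // U ltU; split; first by rewrite -card_gt0 ltnW.
move=> x y xS yS; apply/negPn/negP => nxy.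
pose C := [set a in S | connect (sub_rel e S U) x a].
have pS : part S C (S :\: C).
  apply: part_setD; first by apply/subsetP => a; rewrite inE => /andP[].
    by apply/set0Pn; exists x; rewrite inE xS connect0.
  by apply/set0Pn; exists y; rewrite !inE yS (negPf nxy).
have := kS _ _ pS; rewrite leqNgt => /negP; apply; apply: leq_ltn_trans ltU.
rewrite ecount_card -(card_in_imset (f := fun p : T * T => [set p.1; p.2])).
  apply: subset_leq_card; apply/subsetP => _ /imsetP[[a b] + ->]; rewrite !inE /=.
  case/and3P=> /andP[aS xa] /andP[nxb bS] eab; apply: contraR nxb => abU.
  by rewrite bS /=; apply: connect_trans xa (connect1 _); apply/and4P.
move=> [a b] [a' b']; rewrite !inE /= => /and3P[/andP[aS xa] /andP[+ bS] _].
rewrite bS /= => nxb /and3P[/andP[aS' xa'] /andP[+ bS'] _]; rewrite bS' /= => nxb' /setP E.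
have := E a; have := E b; rewrite !inE !eqxx orbT /=.
have /negPf-> : b != a' by apply: contraNneq nxb => ->.
have /negPf-> : a != b' by apply: contraNneq nxb' => <-.
by rewrite orbF /= => /esym/eqP-> /esym/eqP->.
Qed.

Lemma kconn_cut S X :
  kconn S -> X \subset S -> X != set0 -> S :\: X != set0 -> k <= ecount X (S :\: X).
Proof. by move=> kS XS X0 Y0; apply: kS; apply: part_setD. Qed.

Lemma mincut_le S C D X : mincut S C D ->
  X \subset S -> X != set0 -> S :\: X != set0 -> ecount C D <= ecount X (S :\: X).
Proof. by case/mincutP=> _ _ min XS X0 Y0; apply/min/part_setD. Qed.

(** If the petals [B :&: D] and [B :&: D'] were disjoint, each would have at least [k] boundary
    edges in [G - v], and the neighbours of [v] would supply [k + 2] more in [ecount_petals], whose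
    right side is below [3 * k]. *)
Lemma petals_meet u v A B C D C' D' F F' :
  k + 2 <= deg e v -> kconn (~: [set v]) -> u != v ->
  mincut (~: [set u; v]) A B -> mincut (~: F) C D -> mincut (~: F') C' D' ->
  F \subset A -> F' \subset A -> u \in C -> v \in D -> u \in C' -> v \in D' ->
  B :&: D != set0 -> B :&: D' != set0 ->
  (forall a, a \in A -> e v a -> exists2 b, b \in B & e a b) ->
  {in F :|: F', forall a, ~~ e v a} ->
  B :&: (D :&: D') != set0.
Proof.
move=> degv kv uv mAB mCD mCD' FA F'A uC vD uC' vD' BD BD' adjA nadjF.
apply/negP => /eqP BDD'.
have /mincutP[pAB ltAB _] := mAB; have /mincutP[pCD ltCD _] := mCD.
have /mincutP[pCD' ltCD' _] := mCD'.
have petal X : B :&: X != set0 -> k <= ecount (B :&: X) (~: (B :&: X :|: [set v])).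
  have /partP[_ _ facts] := pAB.
  move=> BX0; rewrite setUC setCU -setDE; apply: kconn_cut => //.
    by apply/subsetP => t; move: (facts t); truth_table.
  apply/set0Pn; exists u; rewrite !inE uv andbT.
  by have := facts u; rewrite !inE eqxx /=; case: (u \in B); rewrite ?orbT.
(* A neighbour of [v] outside [C] and [C'] lies in [D :&: D'], as it avoids [F] and [F']; not being
   in [B], it is in [A] and has a neighbour in [B]. *)
have leq1 : deg e v <= ecount [set v] (C :|: C') + ecount (A :&: (D :&: D')) B.
  have -> : deg e v = #|[set b in C :|: C' | e v b] :|: [set b in A :&: (D :&: D') | e v b]|.
    apply: eq_card => t; rewrite !inE; case evt: (e v t) => /=; last by rewrite !andbF.
    have /partP[_ _ /(_ t)] := pAB; have /partP[_ _ /(_ t)] := pCD.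
    have /partP[_ _ /(_ t)] := pCD'.
    have : t \notin F :|: F' by apply: contraL evt; apply: nadjF.
    have : t \notin B :&: (D :&: D') by rewrite BDD' inE.
    have : t != v by apply: contraTneq evt => ->; rewrite e_irr.
    have : (t == u) ==> (t \in C) by apply/implyP => /eqP->.
    rewrite !inE; case: (t == v) => //=.
    case: (t == u); case: (t \in A); case: (t \in B); case: (t \in C); case: (t \in D);
    case: (t \in C'); case: (t \in D'); case: (t \in F); case: (t \in F') => //=.
  apply: leq_trans (leq_card_setU _ _).1 _; apply: leq_add.
    by rewrite /ecount big_set1 card_nbr.
  rewrite -sum1_card /ecount big_mkcond [leqRHS]big_mkcond; apply: leq_sum => a _.
  rewrite !inE; case aA: (a \in A) => //=; case: (a \in D) => //=.
  case: (a \in D') => //=; case eva: (e v a) => //.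
  have [b bB eab] := adjA a aA eva.
  by rewrite (bigD1 b) //= eab.
have /= := @ecount_petals A B C D C' D' [set u] [set v] F F' pAB pCD FA.
rewrite !sub1set => /(_ uC vD pCD' F'A uC' vD' BDD').
move: (petal D BD) (petal D' BD') leq1 degv ltAB ltCD ltCD'; clear; lia.
Qed.

(** * Single removable vertices, after Mader *)

Hypothesis kG : kconn setT.
Hypothesis mindeg : forall x, k + 2 <= deg e x.

(* A region [W] in which the extremal argument can be run with edges of [J]: the
   vertices of a side inside [W] without neighbours across the cut are again in [J],
   hence removable one at a time. *)
Definition confined J W :=
  [/\ {in J, forall t, kconn (~: [set t])}, J \subset W,
      exists u v A B, [/\ u \in J, v \in J, e u v, mincut (~: [set u; v]) A B
                        & A \subset W]
    & forall u v A B t, u \in J -> v \in J -> e u v ->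
        mincut (~: [set u; v]) A B -> A \subset W -> t \in A ->
        {in B, forall b, ~~ e t b} -> t \in J].

Lemma deg_setD M t : k + 2 - #|M| <= #|[set b | e t b] :\: M|.
Proof.
rewrite leq_subLR; apply: leq_trans (mindeg t) _.
rewrite /deg -(cardsID M [set b | e t b]) leq_add2r.
exact/subset_leq_card/subsetIr.
Qed.

Lemma part_compl_ecount F A B : part (~: F) A B -> ecount A (~: (A :|: F)) = ecount A B.
Proof.
move=> /partP[_ _ AB]; congr ecount; apply/setP => t; apply/eqP.
by move: (AB t); truth_table.
Qed.

(** The surplus of two in the minimum degree pays for the at most two vertices of [F], so
    [interior_edge] applies with [d = k]. *)
Lemma interior_edge_side F A B : #|F| <= 2 -> mincut (~: F) A B ->
  exists z z', [/\ z \in A, z' \in A, e z z',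
    {in B, forall b, ~~ e z b} & {in B, forall b, ~~ e z' b}].
Proof.
move=> F2 /mincutP[pAB ltAB _]; have /partP[A0 _ AB] := pAB.
have [|| z [z' [zA z'A ezz' nz nz']]] := @interior_edge k A F A0.
- move=> t; apply: leq_trans (deg_setD F t); move: F2; clear; lia.
- by rewrite (part_compl_ecount pAB).
exists z, z'; split=> // b bB; apply/negP => ezb; [move: (nz b ezb)|move: (nz' b ezb)];
  by move: (AB b) bB; rewrite !inE; case: (b \in F); case: (b \in A); case: (b \in B).
Qed.

Lemma confined_exists :
  0 < #|T| -> (forall u v, e u v -> ~ kconn (~: [set u; v])) ->
  exists J W, confined J W.
Proof.
move=> /card_gt0P[t0 _] no_edge.
pose Q (p : T * {set T} * {set T}) := mincut (~: [set p.1.1]) p.1.2 p.2.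
case: (pickP Q) => [p0 Qp0|noQ]; last first.
  have [v ev] : exists v, e t0 v.
    have : 0 < deg e t0 by apply: leq_trans (mindeg t0); rewrite addn2.
    by rewrite card_gt0 => /set0Pn[v]; rewrite inE; exists v.
  have [//|[A [B mAB]]] := kconnVmincut (~: [set t0; v]).
    by move=> /(no_edge _ _ ev).
  exists setT, setT; split=> //; last by exists t0, v, A, B; rewrite !inE subsetT.
  move=> t _; have [//|[C [D mCD]]] := kconnVmincut (~: [set t]).
  by have := noQ (t, C, D); rewrite /Q /= mCD.
case: (arg_minnP (fun p : T * {set T} * {set T} => #|p.1.2|) Qp0) => -[[w A] B] /= mAB minA.
have {}minA s C D : mincut (~: [set s]) C D -> #|A| <= #|C|.
  by move=> mCD; have := minA (s, C, D); apply.
rewrite /Q /= in mAB; clear Qp0 p0 Q.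
have /mincutP[pAB ltAB _] := mAB; have /partP[A0 B0 AB] := pAB.
pose J := [set t in A | [forall b in B, ~~ e t b]].
have JP t : reflect (t \in A /\ {in B, forall b, ~~ e t b}) (t \in J).
  rewrite inE; apply: (iffP andP) => -[tA tB]; split=> //; first by move/forall_inP: tB.
  exact/forall_inP.
have shift F' C D : F' != set0 -> F' \subset J -> mincut (~: F') C D -> w \in C ->
    exists Y Y', [/\ mincut (~: F') Y Y', Y \subset w |: A & #|F'| = 1 -> #|Y| < #|A|].
  rewrite -!(setTD F') -sub1set => F'0 F'J mCD wC.
  have [|||Y [Y' [mY YA ltY]]] :=
    mincut_shift kG (subsetT [set w]) (subsetT F') F'0 _ _ _ mCD wC (A := A) (B := B).
  - by rewrite setTD.
  - by apply/subsetP => t /(subsetP F'J) /JP[].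
  - by move=> t b /(subsetP F'J) /JP[_ tB] /tB.
  by exists Y, Y'; rewrite setUC cards1 in ltY *; split=> // F'1; apply: ltY; rewrite F'1.
have orient F' C D : F' \subset J -> mincut (~: F') C D ->
    exists C' D', mincut (~: F') C' D' /\ w \in C'.
  move=> F'J mCD; have /mincutP[/partP[_ _ CD] _ _] := mCD; have := CD w.
  have -> : w \in ~: F'.
    rewrite inE; apply/negP => /(subsetP F'J) /JP[wA _].
    by have := AB w; rewrite wA !inE eqxx.
  case wC: (w \in C); first by exists C, D.
  by case wD: (w \in D) => // _; exists D, C; split=> //; apply: mincutC.
have sub1J t : t \in J -> [set t] \subset J by rewrite sub1set.
exists J, (w |: A); split.
(* A minimum cut of [G - t] could be shifted to one with a side smaller than [A]. *)
- move=> t tJ; have [//|[C0 [D0 mCD0]]] := kconnVmincut (~: [set t]).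
  have [C [D [mCD wC]]] := orient _ _ _ (sub1J t tJ) mCD0.
  have [|Y [Y' [/minA leA _]]] := shift _ _ _ _ (sub1J t tJ) mCD wC.
    by apply/set0Pn; exists t; rewrite inE.
  by rewrite cards1 => /(_ erefl); rewrite ltnNge leA.
- by apply/subsetP => t /JP[tA _]; rewrite inE tA orbT.
- have [|u [v [uA vA euv uB vB]]] := @interior_edge_side [set w] A B _ mAB.
    by rewrite cards1.
  have uJ : u \in J by apply/JP.
  have vJ : v \in J by apply/JP.
  have uvJ : [set u; v] \subset J by rewrite subUset !sub1set uJ.
  have [/(no_edge _ _ euv)//|[C0 [D0 mCD0]]] := kconnVmincut (~: [set u; v]).
  have [C [D [mCD wC]]] := orient _ _ _ uvJ mCD0.
  have [|Y [Y' [mY YA _]]] := shift _ _ _ _ uvJ mCD wC.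
    by apply/set0Pn; exists u; rewrite !inE eqxx.
  by exists u, v, Y, Y'.
(* As [X] lies in [w |: A], all of [B] lies in [Y], so [t] has no neighbour in [B]; and [t] is not
   [w], which has one. *)
move=> u v X Y t uJ vJ euv mXY XW tX tY; have /mincutP[/partP[_ _ XY] _ _] := mXY.
have BY b : b \in B -> b \in Y.
  move=> bB; have := AB b; have /implyP := subsetP XW b; have := XY b; rewrite !inE bB.
  have /negPf-> : b != u.
    by apply: contraTneq uJ => <-; apply/JP => -[bA]; have := AB b; rewrite bA bB andbF.
  have /negPf-> : b != v.
    by apply: contraTneq vJ => <-; apply/JP => -[bA]; have := AB b; rewrite bA bB andbF.
  by case: (b == w); case: (b \in A); case: (b \in X); case: (b \in Y).
apply/JP; split; last by move=> b /BY/tY.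
have := subsetP XW t tX; rewrite inE => /orP[|//]; rewrite inE => /eqP tw.
have [||w' [b [ww' bB ewb]]] := cut_attached kG (subsetT [set w]) (C := A) (D := B).
- by rewrite setTD.
- by [].
by move: ww' ewb; rewrite inE -tw => /eqP->; rewrite (negPf (tY _ (BY b bB))).
Qed.

(** * The smallest side left by an edge of [J] *)

Section Minimal.
Hypothesis no_edge : forall u v, e u v -> ~ kconn (~: [set u; v]).
Variables (J W : {set T}) (u v : T) (A B : {set T}).
Hypotheses (confJW : confined J W) (uJ : u \in J) (vJ : v \in J) (euv : e u v).
Hypotheses (mAB : mincut (~: [set u; v]) A B) (AW : A \subset W).
Hypothesis minA : forall x y C D, x \in J -> y \in J -> e x y ->
  mincut (~: [set x; y]) C D -> C \subset W -> #|A| <= #|C|.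

Let Z := [set t in A | [forall b in B, ~~ e t b]].

Let ZP t : reflect (t \in A /\ {in B, forall b, ~~ e t b}) (t \in Z).
Proof.
rewrite inE; apply: (iffP andP) => -[tA tB]; split=> //; last exact/forall_inP.
by move/forall_inP: tB.
Qed.

Let ZJ t : t \in Z -> t \in J.
Proof.
by have [_ _ _ conf] := confJW; case/ZP=> tA tB; apply: conf euv mAB AW tA tB.
Qed.

Let AB t : (((t != u) && (t != v)) == (t \in A) || (t \in B))
  && ~~ ((t \in A) && (t \in B)).
Proof. by have /mincutP[/partP[_ _ /(_ t)]] := mAB; rewrite !inE negb_or. Qed.

Let uv : u != v.
Proof. by apply: contraTneq euv => ->; rewrite e_irr. Qed.

Let uvW s : s \in [set u; v] -> s \in W.
Proof.
have [_ JW _ _] := confJW.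
by rewrite !inE => /orP[] /eqP->; apply: (subsetP JW).
Qed.

Let setUW X s : X \subset A -> s \in [set u; v] -> X :|: [set s] \subset W.
Proof.
by move=> XA suv; rewrite subUset sub1set uvW // (subset_trans XA AW).
Qed.

(** If [s] and [t] were adjacent, uncrossing inside [G - s], with [r] and [t] as the deleted
    vertices, would give [G - s - t] a minimum cut with a side in [A :|: [set r]] smaller than
    [A]. *)
Lemma inner_not_adjacent s r t :
  [set s; r] = [set u; v] -> s != r -> t \in Z -> ~~ e t s.
Proof.
move=> sr neq_sr tZ; apply/negP => ets.
have /ZP[tA tB] := tZ.
have [suv ruv] : s \in [set u; v] /\ r \in [set u; v] by rewrite -sr !inE !eqxx orbT.
have sJ : s \in J by move: suv; rewrite !inE => /orP[] /eqP->.
have [kJ _ _ _] := confJW.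
have ts : t != s by apply: contraTneq ets => ->; rewrite e_irr.
have pairD a : ~: [set s] :\: [set a] = ~: [set s; a] by rewrite setDE -setCU.
have est : e s t by rewrite e_sym.
have [C [D [mCD rC]]] : exists C D, mincut (~: [set s; t]) C D /\ r \in C.
  have [/(no_edge est)//|[C [D mCD]]] := kconnVmincut (~: [set s; t]).
  have /mincutP[/partP[_ _ /(_ r) facts] _ _] := mCD; move: facts.
  have rt : r != t.
    apply: contraTneq ruv => ->; rewrite !inE negb_or.
    by have /andP[/eqP-> _] := AB t; rewrite tA.
  rewrite !inE (negPf rt) [r == s]eq_sym (negPf neq_sr) /=.
  case rC: (r \in C); first by exists C, D.
  by case rD: (r \in D) => // _; exists D, C; split=> //; apply: mincutC.
have [|||||||||Y [Y' [mY YA]]] := @mincut_shift (~: [set s])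
   [set r] [set t] A B C D.
- exact: kJ.
- by rewrite sub1set !inE eq_sym.
- by rewrite sub1set !inE.
- by apply/set0Pn; exists t; rewrite inE.
- by rewrite pairD sr.
- by rewrite sub1set.
- by move=> a b; rewrite inE => /eqP->; apply: tB.
- by rewrite pairD.
- by rewrite sub1set.
rewrite !cards1 => /(_ isT); rewrite ltnNge (minA sJ (ZJ tZ) est (D := Y')) //.
  by rewrite -pairD.
by apply: subset_trans YA (setUW (subxx _) ruv).
Qed.

Let Zu t : t \in Z -> ~~ e t u.
Proof. by apply: (@inner_not_adjacent u v). Qed.

Let Zv t : t \in Z -> ~~ e t v.
Proof. by apply: (@inner_not_adjacent v u); rewrite // 1?setUC // eq_sym. Qed.

(** Requiring [v] in the second side fixes the orientation, so that minimising [A :&: D] over all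
    these cuts makes sense. *)
Let cutting (p : T * T * {set T} * {set T}) :=
  [&& p.1.1.1 \in Z, p.1.1.2 \in Z, e p.1.1.1 p.1.1.2,
      mincut (~: [set p.1.1.1; p.1.1.2]) p.1.2 p.2 & v \in p.2].

Let ZA F : F \subset Z -> F \subset A.
Proof. by move=> FZ; apply/subsetP => t /(subsetP FZ) /ZP[]. Qed.

Let pairZ x y : x \in Z -> y \in Z -> [set x; y] \subset Z.
Proof. by move=> xZ yZ; rewrite subUset !sub1set xZ. Qed.

(** With [u] and [v] both in [D], uncrossing in the whole graph would give a side within [A], [u]
    and [v] but smaller than [A], against [minA]. *)
Lemma inner_cut_separates x y C D :
  x \in Z -> y \in Z -> e x y -> mincut (~: [set x; y]) C D -> v \in D -> u \in C.
Proof.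
move=> xZ yZ exy mCD vD; apply/negPn/negP => uC.
have pZ := pairZ xZ yZ; have pA := ZA pZ.
have uD : u \in D.
  have /mincutP[/partP[_ _ /(_ u) facts] _ _] := mCD; move: facts; rewrite (negPf uC) /= inE.
  have -> : u \notin [set x; y].
    by apply/negP => /(subsetP pA) uA; have := AB u; rewrite uA eqxx.
  by rewrite andbT => /eqP<-.
have [||||||||Y [Y' [mY YA]]] := @mincut_shift setT
   [set u; v] [set x; y] A B D C kG.
- exact: subsetT.
- exact: subsetT.
- by apply/set0Pn; exists x; rewrite !inE eqxx.
- by rewrite setTD.
- by [].
- by move=> a b /(subsetP pZ) /ZP[_ aB]; apply: aB.
- by rewrite setTD; apply: mincutC.
- by rewrite subUset !sub1set uD.
have xy : x != y by apply: contraTneq exy => ->; rewrite e_irr.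
rewrite !cards2 uv xy => /(_ isT); rewrite ltnNge (@minA x y Y Y') ?ZJ //.
  by rewrite -setTD.
apply: subset_trans YA _; rewrite subUset AW /=.
by apply/subsetP => s; apply: uvW.
Qed.

(** If [C] missed [B], it would lie in [A] without [x], [y] but with [s]: a smaller side inside
    [W]. *)
Lemma inner_cut_outer x y C D s r :
  x \in Z -> y \in Z -> e x y -> mincut (~: [set x; y]) C D ->
  [set s; r] = [set u; v] -> r \notin C -> B :&: C != set0.
Proof.
move=> xZ yZ exy mCD sr rC; apply/negP => /eqP BC0.
have xy : x != y by apply: contraTneq exy => ->; rewrite e_irr.
have CA : C \subset (A :\: [set x; y]) :|: [set s].
  apply/subsetP => t tC; have /mincutP[/partP[_ _ /(_ t) facts] _ _] := mCD; move: facts.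
  have : t \notin B :&: C by rewrite BC0 inE.
  have : t != r by apply: contraTneq tC => ->.
  have : (t \in [set s; r]) = (t \in [set u; v]) by rewrite sr.
  have := AB t; rewrite !inE tC.
  by case: (t == u); case: (t == v); case: (t == r); case: (t == s); case: (t \in A);
    case: (t \in B); case: (t == x); case: (t == y).
have suv : s \in [set u; v] by rewrite -sr !inE eqxx.
have leAC : #|A| <= #|C|.
  apply: (minA (ZJ xZ) (ZJ yZ) exy mCD); apply: subset_trans CA _.
  by apply: setUW suv; apply: subsetDl.
have := (leq_card_setU (A :\: [set x; y]) [set s]).1; have := subset_leq_card CA.
rewrite cardsD (setIidPr (ZA (pairZ xZ yZ))) cards2 xy cards1.
have := subset_leq_card (ZA (pairZ xZ yZ)); rewrite cards2 xy.
by move: leAC; clear; lia.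
Qed.

Lemma minimal_side_absurd : False.
Proof.
have [kJ _ _ _] := confJW; have ku := kJ u uJ; have kv := kJ v vJ.
have exZ x y : x \in Z -> y \in Z -> e x y -> exists C D, cutting (x, y, C, D).
  move=> xZ yZ exy.
  have [/(no_edge exy)//|[C [D mCD]]] := kconnVmincut (~: [set x; y]).
  have /mincutP[/partP[_ _ /(_ v) facts] _ _] := mCD; move: facts; rewrite inE.
  have -> : v \notin [set x; y].
    apply/negP => /(subsetP (ZA (pairZ xZ yZ))) vA.
    by have := AB v; rewrite vA eqxx andbF.
  case vC: (v \in C).
    by exists D, C; rewrite /cutting /= xZ yZ exy vC mincutC.
  by case vD: (v \in D) => // _; exists C, D; rewrite /cutting /= xZ yZ exy mCD.
have [z0 [z1 [z0A z1A ez01 z0B z1B]]] : exists z z', [/\ z \in A, z' \in A, e z z',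
    {in B, forall b, ~~ e z b} & {in B, forall b, ~~ e z' b}].
  by apply: (interior_edge_side _ mAB); rewrite cards2 uv.
have [C0 [D0 cut0]] : exists C D, cutting (z0, z1, C, D) by apply: exZ => //; apply/ZP.
case: (arg_minnP (fun p : T * T * {set T} * {set T} => #|A :&: p.2|) cut0).
move=> [[[x y] C] D] /= /and5P[/= xZ yZ exy mCD vD] minD.
have {}minD x' y' C' D' : cutting (x', y', C', D') -> #|A :&: D| <= #|A :&: D'|.
  exact: minD.
have uC := inner_cut_separates xZ yZ exy mCD vD.
have /mincutP[pCD ltCD _] := mCD; have /partP[_ _ CD] := pCD.
have /mincutP[pAB ltAB _] := mAB.
have vC : v \notin C by have := CD v; rewrite vD andbT; case: (v \in C); rewrite ?andbF.
have uD : u \notin D by have := CD u; rewrite uC; case: (u \in D); rewrite ?andbF.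
have BC0 := inner_cut_outer xZ yZ exy mCD erefl vC.
have BD0 := inner_cut_outer xZ yZ exy (mincutC mCD) (setUC _ _) uD.
have FZ := pairZ xZ yZ; have FA := ZA FZ.
(* The pair [x], [y] has a neighbour in [D]; it is neither in [B] nor [v], because both lie in
   [Z]. *)
have AD0 : A :&: D != set0.
  have [|a [b [aF bD eab]]] := cut_attached kG (subsetT [set x; y]) _ ltCD.
  - by rewrite setTD.
  apply/set0Pn; exists b; rewrite inE bD andbT.
  have aZ := subsetP FZ a aF; have /ZP[_ /(_ b)] := aZ; rewrite eab.
  have bu : b != u by apply: contraTneq bD => ->.
  have bv : b != v by apply: contraTneq eab => ->; apply: Zv.
  have := AB b; rewrite bu bv; case: (b \in A) => //=; case: (b \in B) => // _.
  by move=> /(_ isT).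
have [z [z' [zAD z'AD ezz' nz nz']]] :
  exists z z', [/\ z \in A :&: D, z' \in A :&: D, e z z',
    forall b, e z b -> b \in A :&: D :|: ([set x; y] :|: [set v]) &
    forall b, e z' b -> b \in A :&: D :|: ([set x; y] :|: [set v])].
  (* Discarding [x], [y], [v] leaves degree at least [k - 1]; the edge [uv] in [ecount_two_cuts]
     lowers the boundary of [A :&: D] strictly below [ecount C D], hence below [k - 1]. *)
  apply: (@interior_edge (k - 1)) => //.
    have M3 : #|[set x; y] :|: [set v]| <= 3.
      apply: leq_trans (leq_card_setU _ _).1 _.
      by rewrite cards2 cards1; case: (x != y).
    move=> t; apply: leq_trans (deg_setD _ t); move: M3; clear; lia.
  have UC : [set u] \subset C by rewrite sub1set.
  have VD : [set v] \subset D by rewrite sub1set.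
  have two := ecount_two_cuts pAB pCD FA UC VD.
  have uv1 : 1 <= ecount [set u] [set v].
    by rewrite /ecount !big_set1 euv.
  have leB : ecount A B <= ecount (B :&: C) (~: (B :&: C :|: [set u; v])).
    rewrite setUC setCU -setDE; apply: mincut_le mAB _ _ _ => //.
      by apply/subsetP => t; have := AB t; truth_table.
    have /partP[/set0Pn[a aA] _ _] := pAB; apply/set0Pn; exists a.
    by have := AB a; move: aA; truth_table.
  by move: two uv1 leB ltCD; clear; lia.
have inZ t : t \in A :&: D ->
    (forall b, e t b -> b \in A :&: D :|: ([set x; y] :|: [set v])) -> t \in Z.
  rewrite inE => /andP[tA _] nt; apply/ZP; split=> // b bB.
  apply/negP => /nt; have := AB b; have /implyP := subsetP FA b; rewrite !inE bB.
  by case: (b \in A); case: (b \in D); case: (b == x); case: (b == y); case: (b == v);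
    rewrite ?andbF.
have zZ := inZ z zAD nz; have z'Z := inZ z' z'AD nz'.
have [C' [D' cut']] := exZ z z' zZ z'Z ezz'.
have leD := minD _ _ _ _ cut'.
move: cut' => /and5P[/= _ _ _ mCD' vD'].
have uC' := inner_cut_separates zZ z'Z ezz' mCD' vD'.
have /mincutP[pCD' ltCD' _] := mCD'; have /partP[_ _ CD'] := pCD'.
have vC' : v \notin C'.
  by have := CD' v; rewrite vD' andbT; case: (v \in C'); rewrite ?andbF.
have uD' : u \notin D'.
  by have := CD' u; rewrite uC'; case: (u \in D'); rewrite ?andbF.
have BC0' := inner_cut_outer zZ z'Z ezz' mCD' erefl vC'.
have BD0' := inner_cut_outer zZ z'Z ezz' (mincutC mCD') (setUC _ _) uD'.
have F'Z := pairZ zZ z'Z; have F'A := ZA F'Z.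
have adjA s : {in Z, forall t, ~~ e t s} ->
    forall a, a \in A -> e s a -> exists2 b, b \in B & e a b.
  move=> Zs a aA esa; apply/exists_inP; rewrite -[X in is_true X]negbK negb_exists_in.
  apply/negP => aB; have aZ : a \in Z by rewrite inE aA.
  by have := Zs a aZ; rewrite e_sym esa.
have nadj s : {in Z, forall t, ~~ e t s} ->
    {in [set x; y] :|: [set z; z'], forall a, ~~ e s a}.
  move=> Zs a; rewrite e_sym inE => aF; apply: Zs.
  by case/orP: aF; apply: subsetP.
have BDD : B :&: (D :&: D') != set0.
  exact: (petals_meet (mindeg v) kv uv mAB mCD mCD' FA F'A uC vD uC' vD'
     BD0 BD0' (adjA v Zv) (nadj v Zv)).
(* The same argument with [u] and [v] exchanged and both cuts reversed. *)
have BCC : B :&: (C :&: C') != set0.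
  have mAB' : mincut (~: [set v; u]) A B by rewrite setUC.
  have vu : v != u by rewrite eq_sym.
  exact: (petals_meet (mindeg u) ku vu mAB' (mincutC mCD)
     (mincutC mCD') FA F'A vD uC vD' uC' BC0 BC0' (adjA u Zu) (nadj u Zu)).
(* Otherwise the three corners have boundaries at least [k], [k] and [ecount C D], while [[A | B]]
   and [[C' | D']] have fewer than [k] edges each. *)
have ACD : A :&: (C :&: D') = set0.
  apply/eqP/negPn/negP => ACD0.
  have F'D : [set z; z'] \subset D.
    by move: zAD z'AD; rewrite !inE subUset !sub1set => /andP[_ ->] /andP[_ ->].
  have UC : [set u] \subset C by rewrite sub1set.
  have VD : [set v] \subset D by rewrite sub1set.
  have UC' : [set u] \subset C' by rewrite sub1set.
  have VD' : [set v] \subset D' by rewrite sub1set.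
  have := ecount_corners pAB pCD FA UC VD pCD' F'A UC' VD' F'D.
  have le1 : k <= ecount (B :&: (C :&: C')) (~: (B :&: (C :&: C') :|: [set u])).
    rewrite setUC setCU -setDE; apply: kconn_cut => //.
      by apply/subsetP => t; have := AB t; truth_table.
    by apply/set0Pn; exists v; have := AB v; rewrite !inE [v == u]eq_sym uv eqxx /=;
      case: (v \in B); rewrite ?orbT.
  have le2 : k <= ecount (B :&: (D :&: D')) (~: (B :&: (D :&: D') :|: [set v])).
    rewrite setUC setCU -setDE; apply: kconn_cut => //.
      by apply/subsetP => t; have := AB t; truth_table.
    by apply/set0Pn; exists u; have := AB u; rewrite !inE uv eqxx /=;
      case: (u \in B); rewrite ?orbT.
  have le3 : ecount C D
      <= ecount (A :&: (C :&: D')) (~: [set x; y] :\: (A :&: (C :&: D'))).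
    apply: mincut_le mCD _ ACD0 _.
      by apply/subsetP => t; have := CD t; truth_table.
    by apply/set0Pn; exists v; have := CD v; move: vD vC; truth_table.
  by move: le1 le2 le3 ltAB ltCD'; clear; lia.
have xy : x != y by apply: contraTneq exy => ->; rewrite e_irr.
have zz' : z != z' by apply: contraTneq ezz' => ->; rewrite e_irr.
have sub1 : [set z; z'] \subset (A :&: D) :\: D'.
  apply/subsetP => t tF'; have := CD' t; have : t \in A :&: D.
    by move: tF'; rewrite in_set2 => /orP[] /eqP->.
  by move: tF'; truth_table.
have sub2 : (A :&: D') :\: D \subset [set x; y].
  apply/subsetP => t; have := CD t; have : t \notin A :&: (C :&: D') by rewrite ACD inE.
  by truth_table.
(* The common part [A :&: (D :&: D')] cancels in the minimality of [A :&: D]. The differences, one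
   containing [z], [z'] and the other inside [[set x; y]], must then both have size two. *)
have cD : #|(A :&: D) :\: D'| <= #|(A :&: D') :\: D|.
  rewrite -(leq_add2l #|A :&: (D :&: D')|).
  have := cardsID D' (A :&: D); have := cardsID D (A :&: D').
  rewrite -!setIA [D' :&: D]setIC => -> ->; exact: leD.
have c1 := subset_leq_card sub1; have c2 := subset_leq_card sub2.
rewrite cards2 zz' in c1; rewrite cards2 xy in c2.
have E1 : [set z; z'] = (A :&: D) :\: D'.
  by apply/eqP; rewrite eqEcard sub1 cards2 zz'; move: cD c2; clear; lia.
have E2 : (A :&: D') :\: D = [set x; y].
  by apply/eqP; rewrite eqEcard sub2 cards2 xy; move: cD c1; clear; lia.
have ltDC' : ecount D' C' < k by rewrite ecountC.
(* All neighbours of [z] and [z'] lie in [A :&: D], [x], [y] or [v], so in [D'] or among [z], [z'];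
   but one must lie in [C']. *)
have [|a [b [aF' bC' eab]]] := cut_attached kG (subsetT [set z; z']) _ ltDC'.
- by rewrite setTD partC.
have aZ := subsetP F'Z a aF'.
have : b \in A :&: D :|: ([set x; y] :|: [set v]).
  by move: aF' eab; rewrite in_set2 => /orP[] /eqP->; [apply: nz | apply: nz'].
have bv : b != v by apply: contraTneq eab => ->; apply: Zv.
have := CD' b; rewrite -E2 E1 !inE bC' (negPf bv).
by case: (b \in A); case: (b \in D); case: (b \in D').
Qed.
End Minimal.

(** * Choosing the extremal configuration, and the theorem *)

Lemma exists_removable_edge :
  0 < #|T| -> exists u v, e u v /\ kconn (~: [set u; v]).
Proof.
move=> T0.
case: (pickP (fun p : T * T => e p.1 p.2 &&
    ~~ [exists C, [exists D, mincut (~: [set p.1; p.2]) C D]])).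
  move=> [u v] /= /andP[euv no_cut]; exists u, v; split=> //.
  have [//|[C [D mCD]]] := kconnVmincut (~: [set u; v]).
  by case/existsP: no_cut; exists C; apply/existsP; exists D.
move=> all_cut; exfalso.
have no_edge u v : e u v -> ~ kconn (~: [set u; v]).
  move=> euv kuv; have := all_cut (u, v); rewrite /= euv /= => /negbFE.
  case/existsP=> C /existsP[D /mincutP[/kuv le lt _]].
  by rewrite ltnNge le in lt.
have [J [W confJW]] := confined_exists T0 no_edge.
have [_ _ [u0 [v0 [A0 [B0 [uJ0 vJ0 euv0 mAB0 AW0]]]]] _] := confJW.
pose Q (p : T * T * {set T} * {set T}) :=
  [&& p.1.1.1 \in J, p.1.1.2 \in J, e p.1.1.1 p.1.1.2,
      mincut (~: [set p.1.1.1; p.1.1.2]) p.1.2 p.2 & p.1.2 \subset W].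
have Q0 : Q (u0, v0, A0, B0) by apply/and5P.
case: (arg_minnP (fun p : T * T * {set T} * {set T} => #|p.1.2|) Q0).
move=> [[[u v] A] B] /and5P[/= uJ vJ euv mAB AW] minA.
apply: (minimal_side_absurd no_edge confJW uJ vJ euv mAB AW) => x y C D xJ yJ exy mCD CW.
by apply: (minA (x, y, C, D)); apply/and5P.
Qed.

End RemovableEdge.

Theorem theorem3p1 (T : finType) (e : rel T)
  (e_sym : symmetric e) (e_irr : irreflexive e)
  (k : nat) (k_pos : 0 < k)
  (conn : k_edge_connected e k [set: T])
  (mindeg : forall x : T, k + 2 <= deg e x) :
  exists u v : T, e u v /\ k_edge_connected e k (~: [set u; v]).
Proof.
have kG := k_edge_connected_kconn e_sym conn.
have T0 : 0 < #|T|.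
  by have [_ /(_ set0)[|T0 _]] := conn; rewrite ?cards0 // -cardsT card_gt0.
have [u [v [euv kuv]]] := exists_removable_edge e_sym e_irr kG mindeg T0.
exists u, v; split=> //; apply: kconn_k_edge_connected => //.
(* Since [k] is positive, [u] has at least three neighbours, so at least two vertices survive the
   deletion. *)
have leT : deg e u <= #|[set~ u]|.
  apply: subset_leq_card; apply/subsetP => t; rewrite !inE.
  by apply: contraTneq => ->; rewrite e_irr.
have := cardsC [set u; v]; have := cardsC [set u]; rewrite cards1 cards2.
move: leT (mindeg u) k_pos; case: (u != v); clear; lia.
Qed.
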